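(* Let $F$ be a field with a nontrivial valuation $v$ and value group $\Gamma$, let $E/F$ be a finite field extension, and let $w:E\to M\cup\{\infty\}$ be a quasi-valuation on $E$ with $w|_F=v$, where $M$ is a totally ordered abelian monoid containing $\Gamma$. Equip $E$ with the topology $T_w$ induced by $w$. Then the only nonempty connected subsets of $E$ are the singleton sets $\{x\}$ for $x\in E$.
   Context: A quasi-valuation on a ring $A$ is a function $w:A\to M\cup\{\infty\}$, where $M$ is a totally ordered abelian monoid (written additively, the order being compatible with addition) to which an element $\infty$ greater than all elements of $M$ is adjoined (with $m+\infty=\infty$), such that $w(0)=\infty$, $w(xy)\ge w(x)+w(y)$ and $w(x+y)\ge\min\{w(x),w(y)\}$ for all $x,y\in A$. $\Gamma$ is an ordered submonoid of $M$. Put $M^G=\{m\in M\mid \text{there exists } 0\ne y\in E \text{ with } m\le w(y)\}$, and for $x\in E$, $m\in M^G$ put $U_m(x)=\{y\in E\mid w(y-x)>m\}$. $T_w$ is the topology on $E$ with base $\{U_m(x)\mid x\in E,\ m\in M^G\}$. *)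

(* Defs.v *)
From HB Require Import structures.
From mathcomp Require Import all_boot all_order all_algebra.
From mathcomp Require Import all_classical topology.

Set Implicit Arguments.
Unset Strict Implicit.
Unset Printing Implicit Defensive.

Import Order.TTheory GRing.Theory Num.Theory.
Local Open Scope classical_set_scope.
Local Open Scope ring_scope.

(* Compatibility with the addition is non-strict: in a monoid, x < y need not
   give x + z < y + z. *)
Record compatible_order (T : nmodType) (le : rel T) : Prop := CompatibleOrder {
  compat_anti : antisymmetric le;
  compat_trans : transitive le;
  compat_total : total le;
  compat_wD2r : forall z x y : T, le x y -> le (x + z) (y + z)
}.

(* Num.POrderedZmodule already claims the join of the order and additive
   hierarchies, so HB rejects a new structure joining Order.Total and
   GRing.Nmodule. Hence these two plain structures, whose carriers receive both
   instances, the order with display ring_display. *)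
Structure orderedNmodType := OrderedNmodType {
  onm_base : nmodType;
  onm_le : rel onm_base;
  onm_compat : compatible_order onm_le
}.
Definition onm_sort (M : orderedNmodType) : Type := onm_base M.
Coercion onm_sort : orderedNmodType >-> Sortclass.

Structure orderedZmodType := OrderedZmodType {
  ozm_base : zmodType;
  ozm_le : rel ozm_base;
  ozm_compat : compatible_order ozm_le
}.
Definition ozm_sort (G : orderedZmodType) : Type := ozm_base G.
Coercion ozm_sort : orderedZmodType >-> Sortclass.

HB.instance Definition _ (M : orderedNmodType) := GRing.Nmodule.on (onm_sort M).
HB.instance Definition _ (M : orderedNmodType) :=
  Order.isOrder.Build ring_display (onm_sort M)
    (fun _ _ => erefl) (fun _ _ => erefl) (fun _ _ => erefl)
    (compat_anti (onm_compat M)) (compat_trans (onm_compat M))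
    (compat_total (onm_compat M)).

HB.instance Definition _ (G : orderedZmodType) := GRing.Zmodule.on (ozm_sort G).
HB.instance Definition _ (G : orderedZmodType) :=
  Order.isOrder.Build ring_display (ozm_sort G)
    (fun _ _ => erefl) (fun _ _ => erefl) (fun _ _ => erefl)
    (compat_anti (ozm_compat G)) (compat_trans (ozm_compat G))
    (compat_total (ozm_compat G)).

Fact onm_wD2r (M : orderedNmodType) (z x y : M) : x <= y -> x + z <= y + z.
Proof. exact: (compat_wD2r (onm_compat M)). Qed.

Fact ozm_wD2r (G : orderedZmodType) (z x y : G) : x <= y -> x + z <= y + z.
Proof. exact: (compat_wD2r (ozm_compat G)). Qed.

(* T together with an element Infty, greater than all elements of T and
   absorbing for the addition *)
Definition with_infty (T : Type) : Type := option T.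
Definition Fin (T : Type) (x : T) : with_infty T := Some x.
Definition Infty (T : Type) : with_infty T := None.
Arguments Infty {T}.

Definition map_infty (S T : Type) (f : S -> T) (x : with_infty S) :
  with_infty T := if x is Some s then Fin (f s) else Infty.

HB.instance Definition _ (T : choiceType) := Choice.on (with_infty T).

Section InftyOrder.
Variable T : orderType ring_display.
Implicit Types x y z : with_infty T.

Definition infty_le x y : bool :=
  match x, y with
  | _, None => true
  | None, Some _ => false
  | Some a, Some b => a <= b
  end.

Fact infty_le_anti : antisymmetric infty_le.
Proof. by case=> [a|] [b|] //= /le_anti ->. Qed.

Fact infty_le_trans : transitive infty_le.
Proof. by case=> [b|] [a|] [c|] //=; apply: le_trans. Qed.

Fact infty_le_total : total infty_le.
Proof. by case=> [a|] [b|] //=; apply: le_total. Qed.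

HB.instance Definition _ := Order.isOrder.Build ring_display (with_infty T)
  (fun _ _ => erefl) (fun _ _ => erefl) (fun _ _ => erefl)
  infty_le_anti infty_le_trans infty_le_total.

End InftyOrder.

Section InftyAdd.
Variable T : nmodType.
Implicit Types x y z : with_infty T.

Definition infty_add x y : with_infty T :=
  match x, y with
  | Some a, Some b => Fin (a + b)
  | _, _ => Infty
  end.

Fact infty_addA : associative infty_add.
Proof. by case=> [a|] [b|] [c|] //=; rewrite addrA. Qed.

Fact infty_addC : commutative infty_add.
Proof. by case=> [a|] [b|] //=; rewrite addrC. Qed.

Fact infty_add0 : left_id (Fin 0) infty_add.
Proof. by case=> [a|] //=; rewrite add0r. Qed.

HB.instance Definition _ :=
  GRing.isNmodule.Build (with_infty T) infty_addA infty_addC infty_add0.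

End InftyAdd.

Record quasiValuation (A : pzRingType) (M : orderedNmodType) := QuasiValuation {
  qval :> A -> with_infty M;
  qval0 : qval 0 = Infty;
  qvalM : forall x y, qval x + qval y <= qval (x * y);
  qvalD : forall x y, Order.min (qval x) (qval y) <= qval (x + y)
}.

(* Krull valuation with values in G; G is its value group when the valuation is
   moreover onto G, i.e. attains every Fin g. *)
Record valuation (F : fieldType) (G : orderedZmodType) := Valuation {
  valuation_fun :> F -> with_infty G;
  valuation_eqInfty : forall x, valuation_fun x = Infty <-> x = 0;
  valuationM : forall x y,
    valuation_fun (x * y) = valuation_fun x + valuation_fun y;
  valuationD : forall x y,
    Order.min (valuation_fun x) (valuation_fun y) <= valuation_fun (x + y)
}.

Definition onto_value_group (F : fieldType) (G : orderedZmodType)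
  (v : valuation F G) : Prop := forall g : G, exists x : F, v x = Fin g.

Definition nontrivial_valuation (F : fieldType) (G : orderedZmodType)
  (v : valuation F G) : Prop := exists2 x : F, x != 0 & v x != Fin 0.

(* E equipped with T_w, the topology of base U_m(x), x in E, m in M^G; the
   argument w only selects the topology. *)
Definition qv_space (E : fieldType) (M : orderedNmodType)
  (w : quasiValuation E M) : Type := E.

Definition qv_index (E : fieldType) (M : orderedNmodType) : Type :=
  (E * M)%type.
HB.instance Definition _ (E : fieldType) (M : orderedNmodType) :=
  Choice.on (qv_index E M).
HB.instance Definition _ (E : fieldType) (M : orderedNmodType) :=
  isPointed.Build (qv_index E M) (0, 0).

Section QuasiValuationTopology.
Variables (E : fieldType) (M : orderedNmodType) (w : quasiValuation E M).

(* M^G *)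
Definition qv_radii : set M :=
  [set m | exists2 y : E, y != 0 & Fin m <= w y].

(* U_m(x) *)
Definition qv_ball (m : M) (x : E) : set E := [set y | Fin m < w (y - x)].

Definition qv_index_dom : set (qv_index E M) := [set i | qv_radii i.2].
Definition qv_base (i : qv_index E M) : set (qv_space w) := qv_ball i.2 i.1.

Fact qv_base_cover : \bigcup_(i in qv_index_dom) qv_base i = setT.
Proof.
apply/seteqP; split=> // x _.
have [m mG] : exists m, qv_radii m.
  case w1: (w 1) => [m|].
    by exists m, 1; rewrite ?oner_eq0 // w1.
  by exists 0, 1; rewrite ?oner_eq0 // w1.
by exists (x, m) => //; rewrite /qv_base /qv_ball /= subrr qval0.
Qed.

Fact qv_base_join (i j : qv_index E M) (t : qv_space w) :
  qv_index_dom i -> qv_index_dom j -> qv_base i t -> qv_base j t ->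
  exists k, [/\ qv_index_dom k, qv_base k t &
                qv_base k `<=` qv_base i `&` qv_base j].
Proof.
case: i j => [x m] [y n] Dm Dn; rewrite /qv_base /qv_ball /= => xt yt.
have sub (z s : E) (p q : M) : p <= q -> Fin p < w (t - z) ->
    Fin q < w (s - t) -> Fin p < w (s - z).
  move=> pq tz st; rewrite -[s](subrK t) -addrA.
  apply: lt_le_trans (qvalD w _ _); rewrite lt_min tz andbT.
  by apply: le_lt_trans st.
exists (t, Order.max m n); split => [||s /= st].
- by rewrite /qv_index_dom /=; case: (leP m n).
- by rewrite /= subrr qval0.
- by split; [apply: sub xt st | apply: sub yt st]; rewrite le_max lexx ?orbT.
Qed.

HB.instance Definition _ := Choice.on (qv_space w).
HB.instance Definition _ :=
  isBaseTopological.Build (qv_space w) qv_base_cover qv_base_join.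

End QuasiValuationTopology.

(* Main.v *)
Require Import Defs.
From mathcomp Require Import all_boot all_order all_algebra all_field.
From mathcomp Require Import all_classical topology.

Set Implicit Arguments.
Unset Strict Implicit.
Unset Printing Implicit Defensive.

Import Order.TTheory GRing.Theory Num.Theory.
Local Open Scope classical_set_scope.
Local Open Scope ring_scope.

(** The topology is totally disconnected for the usual ultrametric reason: every
    ball [U_m(x)] is both open and closed, and distinct points are separated by
    a ball. Clopenness needs the relation [m < w (y - x)] to be symmetric and
    transitive; transitivity is the min-inequality, and symmetry holds because
    [w] extends [v], so that [w (-1) = 0]. Separation of [x] from [y] takes the
    radius [m = w (y - x)], which is a legitimate radius (witnessed by [y - x]
    itself) as soon as it is finite. It is finite because a nonzero element [z]
    of the field [E] is invertible: [w z = Infty] would give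
    [w 1 >= w z + w z^-1 = Infty], whereas [w 1 = v 1 = 0]. A connected set that
    contains [x] is then contained in every ball around [x], hence in [{x}]. *)

(** In the value group, [a + a = a] forces [a = 0] by cancellation. *)
Lemma valuation1 (F : fieldType) (G : orderedZmodType) (v : valuation F G) :
  v 1 = Fin 0.
Proof.
have := valuationM v 1 1; rewrite mulr1.
case v1: (v 1) => [a|]; last first.
  by move/eqP: (@oner_neq0 F); case; apply/(valuation_eqInfty v).
by case=> /eqP; rewrite -subr_eq subrr => /eqP <-.
Qed.

(** A totally ordered group has no 2-torsion, and [v (-1)] is 2-torsion. *)
Lemma valuationN1 (F : fieldType) (G : orderedZmodType) (v : valuation F G) :
  v (-1) = Fin 0.
Proof.
have := valuationM v (-1) (-1); rewrite mulrNN mulr1 valuation1.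
case: (v (-1)) => [a|] //= [aa0].
congr Fin; apply: le_anti; case/orP: (le_total (0 : G) a) => a0.
  by have := ozm_wD2r a a0; rewrite -aa0 add0r a0 andbT.
by have := ozm_wD2r a a0; rewrite -aa0 add0r a0.
Qed.

Section QuasiValuationBalls.
Variables (E : fieldType) (M : orderedNmodType) (w : quasiValuation E M).
Hypothesis w1 : w 1 = Fin 0.

Lemma qval_fin (z : E) : z != 0 -> exists m, w z = Fin m.
Proof.
move=> z0; case wz: (w z) => [m|]; first by exists m.
by have := qvalM w z z^-1; rewrite mulfV // wz w1.
Qed.

Hypothesis wN1 : w (-1) = Fin 0.

Lemma qvalN (z : E) : w (- z) = w z.
Proof.
suff le_wN t : w t <= w (- t).
  by apply: le_anti; rewrite le_wN -{2}[z]opprK le_wN.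
by have := qvalM w (-1) t; rewrite wN1 mulN1r add0r.
Qed.

Lemma qv_ball_refl m x : qv_ball w m x x.
Proof. by rewrite /qv_ball /= subrr qval0. Qed.

Lemma qv_ball_sym m x y : qv_ball w m x y -> qv_ball w m y x.
Proof. by rewrite /qv_ball /= -opprB qvalN. Qed.

Lemma qv_ball_trans m x y z :
  qv_ball w m x y -> qv_ball w m y z -> qv_ball w m x z.
Proof.
rewrite /qv_ball /= => xy yz; rewrite -[z](subrK y) -addrA.
by apply: lt_le_trans (qvalD w _ _); rewrite lt_min yz.
Qed.

Lemma open_qv_ball m x :
  qv_radii w m -> open (qv_ball w m x : set (qv_space w)).
Proof.
move=> mG; exists [set (x, m) : qv_index E M]; first by move=> i ->.
by rewrite bigcup_set1.
Qed.

(** Balls of a given radius partition the space, so that the complement of one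
    of them is a union of others. *)
Lemma closed_qv_ball m x :
  qv_radii w m -> closed (qv_ball w m x : set (qv_space w)).
Proof.
move=> mG; rewrite -openC.
rewrite (_ : ~` _ = \bigcup_(y in ~` qv_ball w m x)
                      (qv_ball w m y : set (qv_space w))).
  by apply: bigcup_open => y _; apply: open_qv_ball.
apply/seteqP; split=> [y xy|z [y xy yz] xz].
  by exists y => //; apply: qv_ball_refl.
by apply: xy; apply: qv_ball_trans xz _; apply: qv_ball_sym.
Qed.

Lemma qv_ball_separates (x y : E) :
  y != x -> exists2 m, qv_radii w m & ~ qv_ball w m x y.
Proof.
rewrite -subr_eq0 => yx; have [m wyx] := qval_fin yx.
exists m; first by exists (y - x); rewrite ?wyx.
by rewrite /qv_ball /= wyx ltxx.
Qed.

Lemma connected_sub_qv_ball (C : set (qv_space w)) m x :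
  connected C -> C x -> qv_radii w m -> C `<=` qv_ball w m x.
Proof.
move=> connC Cx mG; apply/setIidPl; apply: connC.
- by exists x; split=> //; apply: qv_ball_refl.
- by exists (qv_ball w m x) => //; apply: open_qv_ball.
- by exists (qv_ball w m x) => //; apply: closed_qv_ball.
Qed.

End QuasiValuationBalls.

Theorem proposition2p12
  (F : fieldType) (Gamma : orderedZmodType) (v : valuation F Gamma)
  (v_onto : onto_value_group v) (v_nontrivial : nontrivial_valuation v)
  (E : fieldExtType F)
  (M : orderedNmodType)
  (iota : {additive Gamma -> M}) (iota_le : {mono iota : x y / x <= y})
  (w : quasiValuation E M)
  (w_ext : forall a : F, w a%:A = map_infty iota (v a))
  (C : set (qv_space w)) :
  (C !=set0 /\ connected C) <-> exists x : qv_space w, C = [set x].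
Proof.
have w1 : w 1 = Fin 0.
  by rewrite -[1](scale1r (1 : E)) w_ext valuation1 /= raddf0.
have wN1 : w (-1) = Fin 0.
  by rewrite -(scaleN1r (1 : E)) w_ext valuationN1 /= raddf0.
split=> [[[x Cx] connC]|[x ->]]; last first.
  by split; [exists x | apply: connected1].
exists x; apply/seteqP; split=> [y Cy|_ -> //].
apply: contrapT => /eqP /(qv_ball_separates w1)[m mG]; apply.
exact: (connected_sub_qv_ball wN1 connC Cx mG).
Qed.
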